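(* Let $0<q<1$. The following assertions hold: (a) There exists some $\mathrm{C}_q>0$ such that every $x\in\mathbb{C}\setminus\{0\}$ satisfies $$\Big|\prod_{j=0}^\infty(1-q^jx)\Big|\le \mathrm{C}_q\,|x|^{\frac12+\frac{\log|x|}{2\log q^{-1}}}.$$ (b) Let $\mathcal{A}$ be any closed set in $\mathbb{C}$ with $q\mathcal{A}\subset\mathcal{A}$ and $q^{-j}\notin\mathcal{A}$ for $j=0,1,2,\ldots$. Then, given any $\delta>0$, there exists a constant $\mathrm{C}_q(\mathcal{A},\delta)>0$ such that for all $x\in\mathcal{A}\setminus\mathbb{D}_\delta$ we have $$\Big|\prod_{j=0}^\infty(1-q^jx)\Big|\ge \mathrm{C}_q(\mathcal{A},\delta)\,|x|^{\frac12+\frac{\log|x|}{2\log q^{-1}}}.$$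
   Context: $\mathbb{D}_\delta=\{z\in\mathbb{C}:|z|<\delta\}$; $q\mathcal{A}=\{qz:z\in\mathcal{A}\}$; $\log$ is the natural logarithm. *)

(* Defs.v *)
From Stdlib Require Import Reals.
From Coquelicot Require Import Coquelicot.
Open Scope R_scope.

Fixpoint cprod (u : nat -> C) (n : nat) : C :=
  match n with
  | O => RtoC 1
  | S m => (cprod u m * u m)%C
  end.

(* The limit of the partial products may be 0: the product of the 1 - q^j x
   vanishes at x = q^(-j). *)
Definition is_cprod_inf (u : nat -> C) (P : C) : Prop :=
  filterlim (cprod u) eventually (locally P).

Definition ex_cprod_inf (u : nat -> C) : Prop :=
  exists P : C, is_cprod_inf u P.

(* Unspecified when [ex_cprod_inf u] fails. *)
Definition cprod_inf (u : nat -> C) : C :=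
  iota (fun P : C_CompleteNormedModule => is_cprod_inf u P).

Lemma is_cprod_inf_unique (u : nat -> C) (P : C) :
  is_cprod_inf u P -> cprod_inf u = P.
Proof.
  intros HP.
  exact (iota_filterlim_locally (V := C_CompleteNormedModule) (cprod u) P HP).
Qed.

Lemma cprod_inf_correct (u : nat -> C) :
  ex_cprod_inf u -> is_cprod_inf u (cprod_inf u).
Proof.
  intros [P HP]. rewrite (is_cprod_inf_unique u P HP). exact HP.
Qed.

Definition qfactor (q : R) (x : C) (j : nat) : C := (1 - RtoC (q ^ j) * x)%C.

(* Main.v *)
(* Write E(r) = r^(1/2 + log r / (2 log(1/q))) and P(x) for the infinite
   product. Both satisfy a q-difference equation, E(r) = r E(q r) and
   P(x) = (1 - x) P(q x), so with y = q^n x one gets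
     |P(x)| / E(|x|) = prod_(1 <= k <= n) |1 - q^k / y| * |P(y)| / E(|y|).
   Choosing n so that y lies in the annulus q <= |y| <= 1 (or n = 0 when
   |x| <= 1) reduces both bounds to estimates that are uniform in n: products
   of the |1 - q^j z| are at most exp(|z| / (1 - q)), and they are bounded
   below as soon as the single factors are, the tail being controlled by the
   Weierstrass product inequality. On A the single factors are bounded below
   since A is closed and misses 1. *)
Require Import Defs.
From Stdlib Require Import Reals Lra Lia Classical.
From Coquelicot Require Import Coquelicot.
Open Scope R_scope.

(** * Partial products and the shift from [x] to [q x] *)

Lemma exp_le_mono (x y : R) : x <= y -> exp x <= exp y.
Proof.
  intros [H|H]; [left; now apply exp_increasing|subst; apply Rle_refl].
Qed.

Lemma RtoC_neq (x y : R) : x <> y -> RtoC x <> RtoC y.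
Proof. intros H E. now apply H, RtoC_inj. Qed.

Lemma cprod_S_front (u : nat -> C) (n : nat) :
  cprod u (S n) = (u O * cprod (fun j => u (S j)) n)%C.
Proof.
  induction n as [|n IH].
  - simpl. ring.
  - change (cprod u (S (S n))) with (cprod u (S n) * u (S n))%C.
    rewrite IH. simpl. ring.
Qed.

Lemma cprod_ext (u v : nat -> C) (n : nat) :
  (forall j, u j = v j) -> cprod u n = cprod v n.
Proof.
  intros H. induction n as [|n IH]; simpl; [reflexivity|].
  now rewrite IH, H.
Qed.

Lemma qfactor_O (q : R) (x : C) : qfactor q x 0 = (1 - x)%C.
Proof. unfold qfactor. simpl. ring. Qed.

Lemma qfactor_S (q : R) (x : C) (j : nat) :
  qfactor q x (S j) = qfactor q (RtoC q * x)%C j.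
Proof.
  unfold qfactor. simpl. rewrite RtoC_mult. ring.
Qed.

Lemma cprod_qfactor_S (q : R) (x : C) (n : nat) :
  cprod (qfactor q x) (S n)
  = ((1 - x) * cprod (qfactor q (RtoC q * x)%C) n)%C.
Proof.
  rewrite cprod_S_front, qfactor_O. f_equal.
  apply cprod_ext. intros j. apply qfactor_S.
Qed.

(** * Uniform bounds on the partial products *)

Lemma geometric_sum_bound (q : R) (n : nat) :
  0 < q < 1 -> 0 <= (1 - q ^ n) / (1 - q) <= / (1 - q).
Proof.
  intros hq.
  assert (H0 : 0 <= q ^ n) by (apply pow_le; lra).
  assert (H1 : q ^ n <= 1) by (rewrite <- (pow1 n); apply pow_incr; lra).
  assert (Hi : 0 < / (1 - q)) by (apply Rinv_0_lt_compat; lra).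
  unfold Rdiv. split; nra.
Qed.

Lemma Cmod_qfactor_le (q : R) (x : C) (j : nat) :
  0 < q -> Cmod (qfactor q x j) <= 1 + q ^ j * Cmod x.
Proof.
  intros hq. unfold qfactor.
  eapply Rle_trans; [apply Cmod_triangle|].
  rewrite Cmod_opp, Cmod_mult, !Cmod_R, Rabs_R1, Rabs_pos_eq; [lra|].
  apply pow_le; lra.
Qed.

Lemma Cmod_qfactor_ge (q : R) (x : C) (j : nat) :
  0 < q -> 1 - q ^ j * Cmod x <= Cmod (qfactor q x j).
Proof.
  intros hq.
  assert (H : Cmod (RtoC 1) <= Cmod (qfactor q x j) + Cmod (RtoC (q ^ j) * x)%C).
  { replace (RtoC 1) with (qfactor q x j + RtoC (q ^ j) * x)%C
      by (unfold qfactor; ring).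
    apply Cmod_triangle. }
  rewrite Cmod_mult, !Cmod_R, Rabs_R1, Rabs_pos_eq in H; [lra|].
  apply pow_le; lra.
Qed.

(** Each factor is at most 1 + t <= exp t with t = q^j |x|. The induction keeps the exact geometric
    sum in the exponent and bounds it only at the end. *)
Lemma cprod_qfactor_upper (q : R) (x : C) (n : nat) :
  0 < q < 1 -> Cmod (cprod (qfactor q x) n) <= exp (Cmod x / (1 - q)).
Proof.
  intros hq.
  apply Rle_trans with (exp (Cmod x * ((1 - q ^ n) / (1 - q)))).
  - induction n as [|n IH].
    + simpl. rewrite Cmod_1.
      replace (Cmod x * ((1 - 1) / (1 - q))) with 0 by (field; lra).
      rewrite exp_0. lra.
    + replace (Cmod x * ((1 - q ^ S n) / (1 - q)))
        with (Cmod x * ((1 - q ^ n) / (1 - q)) + q ^ n * Cmod x)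
        by (simpl; field; lra).
      simpl. rewrite Cmod_mult, exp_plus.
      apply Rmult_le_compat; auto using Cmod_ge_0.
      eapply Rle_trans; [apply Cmod_qfactor_le; lra|].
      apply exp_ineq1_le.
  - apply exp_le_mono. pose proof (geometric_sum_bound q n hq).
    pose proof (Cmod_ge_0 x). unfold Rdiv at 2. nra.
Qed.

(** Weierstrass inequality: a product of factors 1 - t_j is at least 1 minus the sum of the t_j.
    Past index [N] that sum is at most t / (1 - q) <= 1/2, so the tail costs at most a factor 2. *)
Lemma weierstrass_product_lower (q : R) (x : C) (N n : nat) :
  0 < q < 1 -> q ^ N * Cmod x <= (1 - q) / 2 ->
  Cmod (cprod (qfactor q x) N) / 2 <= Cmod (cprod (qfactor q x) (N + n)).
Proof.
  intros hq HN.
  assert (Ht : q ^ N * Cmod x / (1 - q) <= / 2).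
  { apply Rmult_le_reg_r with (1 - q); [lra|].
    replace (q ^ N * Cmod x / (1 - q) * (1 - q)) with (q ^ N * Cmod x)
      by (field; lra). lra. }
  set (t := q ^ N * Cmod x) in *.
  assert (Ht0 : 0 <= t).
  { apply Rmult_le_pos; [apply pow_le; lra|apply Cmod_ge_0]. }
  set (P := Cmod (cprod (qfactor q x) N)).
  assert (HP : 0 <= P) by apply Cmod_ge_0.
  assert (H : P * (1 - t * ((1 - q ^ n) / (1 - q)))
              <= Cmod (cprod (qfactor q x) (N + n))).
  { induction n as [|n IH].
    - rewrite Nat.add_0_r. fold P. simpl.
      replace (t * ((1 - 1) / (1 - q))) with 0 by (field; lra). lra.
    - rewrite Nat.add_succ_r. simpl cprod. rewrite Cmod_mult.
      pose proof (Cmod_qfactor_ge q x (N + n) (proj1 hq)) as Hf.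
      rewrite pow_add in Hf.
      replace (q ^ N * q ^ n * Cmod x) with (t * q ^ n) in Hf
        by (unfold t; ring).
      pose proof (geometric_sum_bound q n hq) as Hg.
      replace ((1 - q ^ S n) / (1 - q)) with ((1 - q ^ n) / (1 - q) + q ^ n)
        by (simpl; field; lra).
      set (s := (1 - q ^ n) / (1 - q)) in *.
      assert (Hs : t * s <= / 2).
      { eapply Rle_trans; [|exact Ht]. unfold Rdiv. nra. }
      assert (0 <= t * s) by (apply Rmult_le_pos; lra).
      assert (Hqn : 0 <= q ^ n <= 1).
      { split; [apply pow_le; lra|rewrite <- (pow1 n); apply pow_incr; lra]. }
      assert (Htq : 0 <= t * q ^ n <= 1).
      { split; [apply Rmult_le_pos; lra|].
        rewrite <- (Rmult_1_r 1). apply Rmult_le_compat; lra. }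
      (* Expanding the product gives 1 - t s - t q^n plus a nonnegative cross term, which is
         dropped. *)
      apply Rle_trans with (P * (1 - t * s) * (1 - t * q ^ n)).
      + assert (0 <= P * (t * s * (t * q ^ n)))
          by (apply Rmult_le_pos; [lra|apply Rmult_le_pos; lra]).
        nra.
      + apply Rmult_le_compat; [|lra|exact IH|exact Hf].
        apply Rmult_le_pos; lra. }
  eapply Rle_trans; [|exact H].
  pose proof (geometric_sum_bound q n hq) as Hg.
  assert (t * ((1 - q ^ n) / (1 - q)) <= / 2).
  { eapply Rle_trans; [|exact Ht]. unfold Rdiv at 2. nra. }
  nra.
Qed.

Lemma cprod_lower_pow (u : nat -> C) (c : R) (n : nat) :
  0 <= c -> (forall j, (j < n)%nat -> c <= Cmod (u j)) ->
  c ^ n <= Cmod (cprod u n).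
Proof.
  intros hc. induction n as [|n IH]; intros H; simpl.
  - rewrite Cmod_1. lra.
  - rewrite Cmod_mult, Rmult_comm.
    apply Rmult_le_compat; auto using pow_le.
Qed.

(** The cut-off [N] depends only on [q] and [M]: the first [N] factors contribute at least c^N and
    the tail at least 1/2. This makes [K] uniform in [x] and in [n]. *)
Lemma cprod_qfactor_lower (q c M : R) :
  0 < q < 1 -> 0 < c <= 1 ->
  exists K : R, 0 < K /\
    forall (x : C) (n : nat), Cmod x <= M ->
      (forall j, (j < n)%nat -> c <= Cmod (qfactor q x j)) ->
      K <= Cmod (cprod (qfactor q x) n).
Proof.
  intros hq hc.
  (* The threshold for q^N under which the tail estimate applies; [Rabs M + 1] is positive for every
     [M] and dominates |x|. *)
  assert (HM : 0 < (1 - q) / 2 / (Rabs M + 1)).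
  { pose proof (Rabs_pos M). apply Rdiv_lt_0_compat; lra. }
  destruct (pow_lt_1_zero q ltac:(rewrite Rabs_pos_eq; lra) _ HM) as [N HN].
  specialize (HN N (le_n N)).
  exists (c ^ N / 2). split.
  { pose proof (pow_lt c N (proj1 hc)). lra. }
  intros x n Hx Hc.
  destruct (Nat.le_gt_cases N n) as [Hle|Hgt].
  - replace n with (N + (n - N))%nat by lia.
    eapply Rle_trans; [|apply weierstrass_product_lower; [exact hq|]].
    + apply Rmult_le_compat_r; [lra|]. apply cprod_lower_pow; [lra|].
      intros j Hj. apply Hc. lia.
    + assert (0 <= q ^ N) by (apply pow_le; lra).
      rewrite Rabs_pos_eq in HN by assumption.
      pose proof (Rabs_pos M). pose proof (Rle_abs M).
      pose proof (Cmod_ge_0 x).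
      apply Rle_trans with ((1 - q) / 2 / (Rabs M + 1) * (Rabs M + 1)).
      * apply Rmult_le_compat; lra.
      * right. field. lra.
  - eapply Rle_trans; [|apply cprod_lower_pow with (c := c); [lra|exact Hc]].
    assert (Hd : c ^ N <= c ^ n).
    { replace N with (n + (N - n))%nat by lia. rewrite pow_add.
      assert (0 <= c ^ n) by (apply pow_le; lra).
      assert (c ^ (N - n) <= 1)
        by (rewrite <- (pow1 (N - n)); apply pow_incr; lra).
      nra. }
    pose proof (pow_lt c N (proj1 hc)). lra.
Qed.

(** * Convergence of the infinite product and passage to the limit *)

Lemma ex_cprod_inf_qfactor (q : R) (x : C) :
  0 < q < 1 -> ex_cprod_inf (qfactor q x).
Proof.
  intros hq.
  set (M := exp (Cmod x / (1 - q)) * Cmod x).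
  (* The partial products are sums of their increments. As the products stay bounded, the increments
     are dominated by the geometric series M q^n. *)
  set (a := fun n => (cprod (qfactor q x) (S n) - cprod (qfactor q x) n)%C).
  assert (Ha : ex_series (V := C_CompleteNormedModule) a).
  { apply (ex_series_le (K := C_AbsRing) (V := C_CompleteNormedModule) a
             (fun n => M * q ^ n)).
    - intros n. change (Cmod (a n) <= M * q ^ n). unfold a. simpl.
      replace (cprod (qfactor q x) n * qfactor q x n - cprod (qfactor q x) n)%C
        with (- (cprod (qfactor q x) n * (RtoC (q ^ n) * x)))%C
        by (unfold qfactor; ring).
      rewrite Cmod_opp, !Cmod_mult, Cmod_R.
      assert (0 <= q ^ n) by (apply pow_le; lra).
      rewrite Rabs_pos_eq by assumption.
      pose proof (cprod_qfactor_upper q x n hq).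
      pose proof (Cmod_ge_0 x). unfold M.
      replace (exp (Cmod x / (1 - q)) * Cmod x * q ^ n)
        with (exp (Cmod x / (1 - q)) * (q ^ n * Cmod x)) by ring.
      apply Rmult_le_compat_r; [|assumption].
      apply Rmult_le_pos; assumption.
    - apply (ex_series_scal (V := R_NormedModule) M).
      apply ex_series_geom. rewrite Rabs_pos_eq; lra. }
  destruct Ha as [l Hl].
  exists (l + RtoC 1)%C. unfold is_cprod_inf.
  assert (Hsum : forall n, sum_n (G := C_AbelianMonoid) a n
                           = (cprod (qfactor q x) (S n) - 1)%C).
  { intros n. induction n as [|n IH].
    - rewrite sum_O. unfold a. simpl. ring.
    - rewrite sum_Sn, IH. unfold a.
      match goal with |- plus ?v ?w = ?z => change ((v + w)%C = z) end. ring. }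
  (* [sum_n a n] includes index n, so the n-th partial product is 1 plus the sum up to n - 1. With
     [pred] this identity holds from n = 1 on, whence the local form of extensionality. *)
  apply (filterlim_ext_loc (F := eventually)
    (fun n => plus (G := C_NormedModule)
                (sum_n (G := C_AbelianMonoid) a (pred n)) (RtoC 1))).
  { exists 1%nat. intros [|n] Hn; [lia|]. simpl pred. rewrite Hsum.
    match goal with |- plus ?v ?w = ?z => change ((v + w)%C = z) end. ring. }
  apply (filterlim_comp_2 (G := locally l) (H := locally (RtoC 1))).
  - apply (filterlim_comp _ _ _ pred (sum_n (G := C_AbelianMonoid) a)
             eventually eventually); [|exact Hl].
    intros P [N HN]. exists (S N). intros n Hn. apply HN. lia.
  - apply filterlim_const.
  - apply (filterlim_plus (K := C_AbsRing) (V := C_NormedModule) l (RtoC 1)).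
Qed.

Lemma is_lim_seq_Cmod_cprod (u : nat -> C) :
  ex_cprod_inf u ->
  is_lim_seq (fun n => Cmod (cprod u n)) (Cmod (cprod_inf u)).
Proof.
  intros H. apply cprod_inf_correct in H.
  apply (filterlim_comp _ _ _ (cprod u) Cmod eventually
           (locally (cprod_inf u))); [exact H|].
  apply (filterlim_norm (K := C_AbsRing) (V := C_NormedModule)).
Qed.

Lemma cprod_inf_le (u : nat -> C) (n : nat) (B : R) :
  ex_cprod_inf u -> (forall m, Cmod (cprod u (n + m)) <= B) ->
  Cmod (cprod_inf u) <= B.
Proof.
  intros Hex H.
  apply (is_lim_seq_le_loc (fun n => Cmod (cprod u n)) (fun _ => B)
           (Cmod (cprod_inf u)) B).
  - exists n. intros m Hm. replace m with (n + (m - n))%nat by lia. apply H.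
  - now apply is_lim_seq_Cmod_cprod.
  - apply is_lim_seq_const.
Qed.

Lemma cprod_inf_ge (u : nat -> C) (n : nat) (B : R) :
  ex_cprod_inf u -> (forall m, B <= Cmod (cprod u (n + m))) ->
  B <= Cmod (cprod_inf u).
Proof.
  intros Hex H.
  apply (is_lim_seq_le_loc (fun _ => B) (fun n => Cmod (cprod u n))
           B (Cmod (cprod_inf u))).
  - exists n. intros m Hm. replace m with (n + (m - n))%nat by lia. apply H.
  - apply is_lim_seq_const.
  - now apply is_lim_seq_Cmod_cprod.
Qed.

(** * The comparison function and the splitting of partial products *)

Definition growth (q r : R) : R :=
  Rpower r (1 / 2 + ln r / (2 * ln (/ q))).

Lemma ln_inv_pos (q : R) : 0 < q < 1 -> 0 < ln (/ q).
Proof.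
  intros hq. rewrite <- ln_1. apply ln_increasing; [lra|].
  rewrite <- Rinv_1. apply Rinv_lt_contravar; lra.
Qed.

Lemma growth_pos (q r : R) : 0 < growth q r.
Proof. apply exp_pos. Qed.

(** With u = ln r and l = ln(1/q), the logarithm of [growth] is u/2 + u^2/(2l); replacing u by u + l
    increases it by exactly u + l = ln(r/q). *)
Lemma growth_div (q r : R) :
  0 < q < 1 -> 0 < r -> growth q (r / q) = r / q * growth q r.
Proof.
  intros hq hr. pose proof (ln_inv_pos q hq) as hl.
  assert (Hi : 0 < / q) by (apply Rinv_0_lt_compat; lra).
  unfold growth, Rpower.
  assert (Hrq : r / q = exp (ln r + ln (/ q))).
  { rewrite exp_plus, !exp_ln by assumption. reflexivity. }
  rewrite Hrq, ln_exp, <- exp_plus.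
  f_equal. field. lra.
Qed.

Lemma growth_lower (q r : R) :
  0 < q < 1 -> exp (- ln (/ q) / 8) <= growth q r.
Proof.
  intros hq. pose proof (ln_inv_pos q hq) as hl.
  unfold growth, Rpower. apply exp_le_mono.
  set (l := ln (/ q)) in *. set (u := ln r).
  (* Completing the square: the minimum -l/8 is attained at u = -l/2. *)
  replace ((1 / 2 + u / (2 * l)) * u)
    with (- l / 8 + (u + l / 2) ^ 2 * / (2 * l)) by (field; lra).
  assert (0 < / (2 * l)) by (apply Rinv_0_lt_compat; lra).
  pose proof (pow2_ge_0 (u + l / 2)). nra.
Qed.

(** For r <= 1 the linear term u/2 of the exponent is at most 0, and u^2 is at most (ln d)^2. *)
Lemma growth_upper (q d r : R) :
  0 < q < 1 -> 0 < d -> d <= r <= 1 ->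
  growth q r <= exp (ln d ^ 2 / (2 * ln (/ q))).
Proof.
  intros hq hd hr. pose proof (ln_inv_pos q hq) as hl.
  unfold growth, Rpower. apply exp_le_mono.
  assert (Hu0 : ln r <= 0) by (rewrite <- ln_1; apply ln_le; lra).
  assert (Hdu : ln d <= ln r) by (apply ln_le; lra).
  set (l := ln (/ q)) in *. set (u := ln r) in *. set (v := ln d) in *.
  assert (0 < / (2 * l)) by (apply Rinv_0_lt_compat; lra).
  unfold Rdiv. assert (u ^ 2 <= v ^ 2) by nra. nra.
Qed.

(* The factors [1 - x], ..., [1 - q^(n-1) x] with [x = y / q^n] are rewritten
   as [- (q^j x) * (1 - 1 / (q^j x))]; the monomials combine to the quotient
   of the growth functions, the rest is the product attached to [q / y]. *)
Lemma cprod_qfactor_split (q : R) (y : C) (n m : nat) :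
  0 < q < 1 -> y <> RtoC 0 ->
  Cmod (cprod (qfactor q (y * RtoC (/ q ^ n))%C) (n + m)) * growth q (Cmod y)
  = Cmod (cprod (qfactor q (RtoC q / y)%C) n) * Cmod (cprod (qfactor q y) m)
    * growth q (Cmod y / q ^ n).
Proof.
  intros hq hy.
  assert (hy0 : 0 < Cmod y) by now apply Cmod_gt_0.
  assert (hqC : RtoC q <> RtoC 0) by (apply RtoC_neq; lra).
  induction n as [|n IH].
  - simpl. rewrite Cmod_1, Rinv_1, Cmult_1_r. unfold Rdiv.
    rewrite Rinv_1, !Rmult_1_r. ring.
  - assert (hqn : q ^ n <> 0) by (apply pow_nonzero; lra).
    assert (hqn0 : 0 < q ^ n) by (apply pow_lt; lra).
    assert (hqnC : RtoC (q ^ n) <> RtoC 0) by now apply RtoC_neq.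
    assert (Hinv : RtoC (/ q ^ S n) = (/ (RtoC q * RtoC (q ^ n)))%C).
    { rewrite <- RtoC_mult, <- RtoC_inv; [reflexivity|].
      apply Rmult_integral_contrapositive. split; lra. }
    (* The leading factor on the left will match the last factor, of index [n], of the product
       attached to q / y. *)
    rewrite Nat.add_succ_l, cprod_qfactor_S, Cmod_mult.
    replace (RtoC q * (y * RtoC (/ q ^ S n)))%C with (y * RtoC (/ q ^ n))%C.
    2: { rewrite Hinv, RtoC_inv by assumption. field. now split. }
    rewrite Rmult_assoc, IH.
    replace (Cmod y / q ^ S n) with (Cmod y / q ^ n / q)
      by (simpl; field; lra).
    rewrite growth_div; [|exact hq|apply Rdiv_lt_0_compat; assumption].
    simpl cprod. rewrite Cmod_mult.
    assert (Hf : Cmod (1 - y * RtoC (/ q ^ S n))%C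
                 = Cmod (qfactor q (RtoC q / y)%C n) * (Cmod y / q ^ n / q)).
    { replace (Cmod y / q ^ n / q) with (Cmod (- (y * RtoC (/ q ^ S n)))%C).
      - rewrite <- Cmod_mult. f_equal. rewrite Hinv. unfold qfactor.
        field. now repeat split.
      - rewrite Cmod_opp, Cmod_mult, Cmod_R, Rabs_pos_eq.
        + simpl. field. lra.
        + left. apply Rinv_0_lt_compat, pow_lt. lra. }
    rewrite Hf. ring.
Qed.

(** * Rescaling along the orbit of x *)

Lemma scale_into_annulus (q : R) (x : C) :
  0 < q < 1 ->
  exists n : nat,
    q ^ n * Cmod x <= 1 /\ (n = O \/ q <= q ^ n * Cmod x).
Proof.
  intros hq.
  assert (Hex : exists n, q ^ n * Cmod x <= 1).
  { assert (Hp : 0 < / (Cmod x + 1)).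
    { pose proof (Cmod_ge_0 x). apply Rinv_0_lt_compat. lra. }
    destruct (pow_lt_1_zero q ltac:(rewrite Rabs_pos_eq; lra) _ Hp) as [N HN].
    exists N. specialize (HN N (le_n N)).
    assert (0 <= q ^ N) by (apply pow_le; lra).
    rewrite Rabs_pos_eq in HN by assumption.
    pose proof (Cmod_ge_0 x).
    apply Rle_trans with (/ (Cmod x + 1) * (Cmod x + 1)).
    - apply Rmult_le_compat; lra.
    - right. field. lra. }
  (* Descent to the least admissible exponent: if it is positive, its predecessor leaves the modulus
     above 1, so one more factor q keeps it above q. *)
  destruct Hex as [n Hn].
  induction n as [|n IH].
  - exists O. auto.
  - destruct (Rle_dec (q ^ n * Cmod x) 1) as [H|H]; [auto|].
    exists (S n). split; [exact Hn|right]. simpl. nra.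
Qed.

Lemma orbit_rescale (q : R) (x : C) (n : nat) :
  0 < q -> (RtoC (q ^ n) * x * RtoC (/ q ^ n))%C = x.
Proof.
  intros hq.
  assert (H : q ^ n <> 0) by (apply pow_nonzero; lra).
  rewrite RtoC_inv by assumption. field. now apply RtoC_neq.
Qed.

Lemma Cmod_orbit (q : R) (x : C) (n : nat) :
  0 < q -> Cmod (RtoC (q ^ n) * x)%C = q ^ n * Cmod x.
Proof.
  intros hq. rewrite Cmod_mult, Cmod_R, Rabs_pos_eq; [reflexivity|].
  apply pow_le; lra.
Qed.

Lemma cprod_qfactor_rescaled (q : R) (x : C) (n m : nat) :
  0 < q < 1 -> x <> RtoC 0 ->
  let y := (RtoC (q ^ n) * x)%C in
  Cmod (cprod (qfactor q x) (n + m))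
  = Cmod (cprod (qfactor q (RtoC q / y)%C) n) * Cmod (cprod (qfactor q y) m)
    / growth q (Cmod y) * growth q (Cmod x).
Proof.
  intros hq hx y.
  assert (hqn : q ^ n <> 0) by (apply pow_nonzero; lra).
  assert (hy : y <> RtoC 0).
  { apply Cmult_neq_0; [now apply RtoC_neq|exact hx]. }
  pose proof (cprod_qfactor_split q y n m hq hy) as H.
  unfold y in H at 1. rewrite orbit_rescale in H by lra.
  replace (Cmod y / q ^ n) with (Cmod x) in H
    by (unfold y; rewrite Cmod_orbit by lra; field; assumption).
  pose proof (growth_pos q (Cmod y)).
  apply Rmult_eq_reg_r with (growth q (Cmod y)); [|lra].
  rewrite H. field. lra.
Qed.

(** * The upper bound *)

Lemma qpochhammer_upper (q : R) :
  0 < q < 1 ->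
  exists K : R, 0 < K /\
    forall x : C, x <> RtoC 0 ->
      Cmod (cprod_inf (qfactor q x)) <= K * growth q (Cmod x).
Proof.
  intros hq.
  set (e := exp (/ (1 - q))). set (g := exp (- ln (/ q) / 8)).
  assert (he : 0 < e) by apply exp_pos.
  assert (hg : 0 < g) by apply exp_pos.
  (* One [e] for each of the two products, attached to q / y and y, and [g] for the global minimum
     of [growth]. *)
  exists (e * e / g). split.
  { apply Rdiv_lt_0_compat; [|exact hg]. now apply Rmult_lt_0_compat. }
  intros x hx.
  destruct (scale_into_annulus q x hq) as [n [Hn Hn']].
  apply (cprod_inf_le _ n); [now apply ex_cprod_inf_qfactor|].
  intros m. rewrite (cprod_qfactor_rescaled q x n m hq hx).
  rewrite <- Cmod_orbit in Hn, Hn' by lra.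
  set (y := (RtoC (q ^ n) * x)%C) in *.
  assert (Hexp : forall z k, Cmod z <= 1 -> Cmod (cprod (qfactor q z) k) <= e).
  { intros z k Hz. eapply Rle_trans; [now apply cprod_qfactor_upper|].
    apply exp_le_mono. unfold Rdiv. rewrite <- (Rmult_1_l (/ (1 - q))) at 2.
    apply Rmult_le_compat_r; [|exact Hz].
    left. apply Rinv_0_lt_compat. lra. }
  apply Rmult_le_compat_r; [left; apply growth_pos|].
  unfold Rdiv. apply Rmult_le_compat.
  - apply Rmult_le_pos; apply Cmod_ge_0.
  - left. apply Rinv_0_lt_compat, growth_pos.
  - apply Rmult_le_compat; auto using Cmod_ge_0.
    (* For n = 0 the product attached to q / y is empty; otherwise |y| >= q puts q / y in the closed
       unit disc. *)
    destruct Hn' as [->|Hy].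
    + apply Rle_trans with 1; [simpl; rewrite Cmod_1; lra|].
      rewrite <- exp_0. apply exp_le_mono.
      left. apply Rinv_0_lt_compat. lra.
    + apply Hexp. rewrite Cmod_div, Cmod_R, Rabs_pos_eq by
        (try (apply Cmod_gt_0); lra).
      apply Rmult_le_reg_r with (Cmod y); [lra|].
      replace (q / Cmod y * Cmod y) with q by (field; lra). lra.
  - apply Rinv_le_contravar; [exact hg|]. now apply growth_lower.
Qed.

(** * The lower bound on a closed set stable under q *)

Lemma orbit_closed (q : R) (A : C -> Prop) (x : C) (n : nat) :
  (forall z, A z -> A (RtoC q * z)%C) -> A x -> A (RtoC (q ^ n) * x)%C.
Proof.
  intros HA Hx. induction n as [|n IH].
  - simpl. now rewrite Cmult_1_l.
  - simpl. rewrite RtoC_mult, <- Cmult_assoc. now apply HA.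
Qed.

Lemma closed_away_from (A : C -> Prop) (a : C) :
  closed A -> ~ A a ->
  exists eps : R, 0 < eps /\ forall z, A z -> eps <= Cmod (a - z)%C.
Proof.
  intros Hcl Ha.
  assert (Hloc : locally a (fun z => ~ A z)).
  { apply NNPP. intros H. apply Ha. now apply Hcl. }
  apply (locally_norm_le_locally (K := C_AbsRing) (V := C_NormedModule)) in Hloc.
  destruct Hloc as [eps Heps].
  exists eps. split; [apply cond_pos|].
  intros z Hz. apply Rnot_lt_le. intros H. apply (Heps z); [|exact Hz].
  change (Cmod (z - a)%C < eps).
  replace (z - a)%C with (- (a - z))%C by ring. now rewrite Cmod_opp.
Qed.

(** The modulus equals |1 - z| / |z|. If |z| <= 2 the hypothesis suffices; if |z| > 2 then |1 - z|
    >= |z| - 1 >= |z| / 2. *)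
Lemma Cmod_one_sub_inv_ge (z : C) (eps : R) :
  0 < eps <= 1 -> z <> RtoC 0 -> eps <= Cmod (1 - z)%C ->
  eps / 2 <= Cmod (1 - / z)%C.
Proof.
  intros he hz H.
  assert (hz0 : 0 < Cmod z) by now apply Cmod_gt_0.
  assert (Heq : Cmod (1 - / z)%C * Cmod z = Cmod (1 - z)%C).
  { rewrite <- Cmod_mult, <- (Cmod_opp (1 - z)%C). f_equal. now field. }
  assert (Htri : Cmod z <= Cmod (1 - z)%C + 1).
  { pose proof (Cmod_triangle (- (1 - z))%C (RtoC 1)) as Ht.
    rewrite Cmod_opp, Cmod_1 in Ht.
    now replace (- (1 - z) + 1)%C with z in Ht by ring. }
  apply Rmult_le_reg_r with (Cmod z); [exact hz0|]. rewrite Heq.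
  destruct (Rle_dec (Cmod z) 2); nra.
Qed.

Lemma qpochhammer_lower (q : R) (A : C -> Prop) (delta : R) :
  0 < q < 1 -> closed A ->
  (forall z, A z -> A (RtoC q * z)%C) -> ~ A (RtoC 1) -> 0 < delta ->
  exists K : R, 0 < K /\
    forall x : C, A x -> delta <= Cmod x ->
      K * growth q (Cmod x) <= Cmod (cprod_inf (qfactor q x)).
Proof.
  intros hq Hcl HA H1 hd.
  destruct (closed_away_from A (RtoC 1) Hcl H1) as [eps0 [he0 Heps0]].
  set (eps := Rmin eps0 1).
  assert (he : 0 < eps <= 1).
  { split; [apply Rmin_glb_lt; lra|apply Rmin_r]. }
  assert (Heps : forall z, A z -> eps <= Cmod (1 - z)%C).
  { intros z Hz. eapply Rle_trans; [apply Rmin_l|]. now apply Heps0. }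
  (* A lower bound for |y| in both cases: y = x when n = 0, and |y| >= q otherwise. *)
  set (d := Rmin delta q).
  assert (hd' : 0 < d) by (apply Rmin_glb_lt; lra).
  (* [K1] serves the product at y, where |y| <= 1; [K2] the one at q / y, of modulus at most q / d,
     whose factors are inverted and lose a factor 2. *)
  destruct (cprod_qfactor_lower q eps 1 hq he) as [K1 [hK1 HK1]].
  destruct (cprod_qfactor_lower q (eps / 2) (q / d) hq ltac:(lra))
    as [K2 [hK2 HK2]].
  set (g := exp (ln d ^ 2 / (2 * ln (/ q)))).
  assert (hg : 0 < g) by apply exp_pos.
  exists (K2 * K1 / g). split.
  { apply Rdiv_lt_0_compat; [|exact hg]. now apply Rmult_lt_0_compat. }
  intros x Hx Hdx.
  assert (hx : x <> RtoC 0) by (apply Cmod_gt_0; lra).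
  destruct (scale_into_annulus q x hq) as [n [Hn Hn']].
  apply (cprod_inf_ge _ n); [now apply ex_cprod_inf_qfactor|].
  intros m. rewrite (cprod_qfactor_rescaled q x n m hq hx).
  rewrite <- Cmod_orbit in Hn, Hn' by lra.
  set (y := (RtoC (q ^ n) * x)%C) in *.
  assert (Hdy : d <= Cmod y).
  { destruct Hn' as [->|Hy].
    - unfold y. rewrite Cmod_orbit by lra. simpl. rewrite Rmult_1_l.
      eapply Rle_trans; [apply Rmin_l|exact Hdx].
    - eapply Rle_trans; [apply Rmin_r|exact Hy]. }
  assert (hy : y <> RtoC 0) by (apply Cmod_gt_0; lra).
  assert (HAy : A y) by now apply orbit_closed.
  apply Rmult_le_compat_r; [left; apply growth_pos|].
  unfold Rdiv. apply Rmult_le_compat.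
  - apply Rmult_le_pos; lra.
  - left. now apply Rinv_0_lt_compat.
  - apply Rmult_le_compat; try lra.
    + apply HK2.
      * rewrite Cmod_div, Cmod_R, Rabs_pos_eq by (assumption || lra).
        apply Rmult_le_compat_l; [lra|]. now apply Rinv_le_contravar.
      * (* The factor is [1 - 1/z] for [z = q^(n-1-j) x], a point of [A]. *)
        intros j Hj.
        set (z := (RtoC (q ^ (n - S j)) * x)%C).
        assert (Hz : A z) by now apply orbit_closed.
        assert (hqk : forall k, RtoC (q ^ k) <> RtoC 0)
          by (intros k; apply RtoC_neq, pow_nonzero; lra).
        assert (hz : z <> RtoC 0) by now apply Cmult_neq_0.
        replace (qfactor q (RtoC q / y)%C j) with (1 - / z)%C.
        { apply Cmod_one_sub_inv_ge; auto. }
        assert (Hyz : y = (RtoC q * RtoC (q ^ j) * z)%C).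
        { unfold y, z. replace n with (S j + (n - S j))%nat at 1 by lia.
          rewrite pow_add. simpl. rewrite !RtoC_mult. ring. }
        unfold qfactor. rewrite Hyz. field.
        repeat split; auto. apply RtoC_neq. lra.
    + apply HK1; [lra|]. intros j _.
      apply Heps. now apply orbit_closed.
  - apply Rinv_le_contravar; [apply growth_pos|].
    apply growth_upper; auto.
Qed.

Theorem lemma3p1 (q : R) (hq0 : 0 < q) (hq1 : q < 1) :
  (exists Cq : R, 0 < Cq /\
     forall x : C, x <> RtoC 0 ->
       ex_cprod_inf (qfactor q x) /\
       Cmod (cprod_inf (qfactor q x))
         <= Cq * Rpower (Cmod x) (1 / 2 + ln (Cmod x) / (2 * ln (/ q))))
  /\
  (forall A : C -> Prop,
     closed A ->
     (forall z : C, A z -> A (RtoC q * z)%C) ->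
     (forall j : nat, ~ A (RtoC (/ q ^ j))) ->
     forall delta : R, 0 < delta ->
       exists CqA : R, 0 < CqA /\
         forall x : C, A x -> ~ (Cmod x < delta) ->
           ex_cprod_inf (qfactor q x) /\
           Cmod (cprod_inf (qfactor q x))
             >= CqA * Rpower (Cmod x) (1 / 2 + ln (Cmod x) / (2 * ln (/ q)))).
Proof.
  assert (hq : 0 < q < 1) by (split; assumption).
  split.
  - destruct (qpochhammer_upper q hq) as [K [hK HK]].
    exists K. split; [exact hK|]. intros x hx.
    split; [now apply ex_cprod_inf_qfactor|]. now apply HK.
  - intros A Hcl HA Hj delta hd.
    assert (H1 : ~ A (RtoC 1)).
    { specialize (Hj O). simpl in Hj. now rewrite Rinv_1 in Hj. }
    destruct (qpochhammer_lower q A delta hq Hcl HA H1 hd) as [K [hK HK]].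
    exists K. split; [exact hK|]. intros x Hx Hdx.
    split; [now apply ex_cprod_inf_qfactor|].
    apply Rle_ge, HK; [exact Hx|]. now apply Rnot_lt_le.
Qed.
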